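(* Not every connected graph is a BDM graph. More precisely: (a) there exists a bipartite graph that is not a BDM graph; (b) there exists a distance-hereditary graph of order at least $8$ that is not a BDM graph; (c) there exists a split graph of diameter $3$ and order at least $10$ that is not a BDM graph.
   Context: All graphs are undirected, simple, finite and connected; a graph of order $n$ has vertex set $[n]=\{1,\ldots,n\}$ unless otherwise specified. $d_G(u,v)$ denotes the distance between $u$ and $v$ in $G$, and $N(v)$ denotes the open neighborhood of $v$. A graph is distance-hereditary if every induced path is isometric. A split graph is a connected graph whose vertex set can be partitioned into a clique and an independent set. A vertex $v$ is a boundary vertex of a vertex $u$ if $d_G(u,w)\le d_G(u,v)$ for every $w\in N(v)$; $\partial(u)$ is the set of boundary vertices of $u$, and the boundary of $G$ is $\partial(G)=\bigcup_{u\in V(G)}\partial(u)$. The boundary distance matrix $\hat{D}_G$ is the square matrix indexed by $\partial(G)$ with entries $[\hat{D}_G]_{ij}=d_G(i,j)$ for $i,j\in\partial(G)$. A graph $G$ of order $n$ is called a BDM graph (boundary-distance-matrix constructible) if it is uniquely determined by $\hat{D}_G$, provided that both $n$ and $\partial(G)$ are prescribed; that is, every connected graph $G'$ on the vertex set $V(G)$ with $\partial(G')=\partial(G)$ and $\hat{D}_{G'}=\hat{D}_G$ is isomorphic to $G$. *)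

(* Defs.v *)
From mathcomp Require Import all_boot perm matrix.
Set Implicit Arguments.
Unset Strict Implicit.
Unset Printing Implicit Defensive.

(* Finite simple connected graphs of order [n], with vertices 0, ..., n-1. *)
Record cgraph (n : nat) := CGraph {
  adj :> rel 'I_n;
  cgraph_order_gt0 : 0 < n;
  adj_sym : symmetric adj;
  adj_irr : irreflexive adj;
  adj_connected : forall x y, connect adj x y
}.

Section Graphs.
Variable T : finType.
Implicit Types (e : rel T) (A B : {set T}).

(* The least length of a walk from [x] to [y].  Walks of length at least #|T|
   need not be tried, since a shortest walk has no repeated vertex; the
   junk value for unconnected vertices is #|T|. *)
Definition dist e (x y : T) : nat :=
  find (fun k => [exists p : k.-tuple T, path e x p && (last x p == y)])
       (iota 0 #|T|).

Definition diameter e : nat := \max_(x : T) \max_(y : T) dist e x y.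

Definition boundary_of e (u : T) : {set T} :=
  [set v | [forall w, e v w ==> (dist e u w <= dist e u v)]].

Definition boundary e : {set T} := \bigcup_(u : T) boundary_of e u.

(* Rows and columns follow the enumeration of [B], which depends only on
   the set [B]. *)
Definition dist_mx e B : 'M[nat]_#|B| :=
  \matrix_(i, j) dist e (enum_val i) (enum_val j).

Definition clique e A := {in A &, forall x y, x != y -> e x y}.
Definition independent e A := {in A &, forall x y, ~~ e x y}.

Definition bipartite e :=
  exists A : {set T}, independent e A /\ independent e (~: A).

Definition split_graph e :=
  exists A : {set T}, clique e A /\ independent e (~: A).

End Graphs.

(* The path on [k] vertices. *)
Definition path_rel (k : nat) : rel 'I_k :=
  fun i j => (i.+1 == j :> nat) || (j.+1 == i :> nat).

(* [f] exhibits an induced copy of the path on [k] vertices. *)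
Definition induced_path (T : finType) (e : rel T) (k : nat) (f : 'I_k -> T) :=
  injective f /\ forall i j, e (f i) (f j) = path_rel i j.

Definition isometric_path (T : finType) (e : rel T) (k : nat)
    (f : 'I_k -> T) :=
  forall i j, dist e (f i) (f j) = dist (@path_rel k) i j.

Definition distance_hereditary (T : finType) (e : rel T) :=
  forall (k : nat) (f : 'I_k -> T), induced_path e f -> isometric_path e f.

Definition isomorphic (n : nat) (G H : cgraph n) :=
  exists s : {perm 'I_n}, forall x y, H (s x) (s y) = G x y.

Definition bd_mx (n : nat) (G : cgraph n) := dist_mx G (boundary G).

(* Once [boundary H = boundary G], the boundary distance matrix of [H] is
   [dist_mx H (boundary G)]; this form has the same type as [bd_mx G]. *)
Definition BDM (n : nat) (G : cgraph n) :=
  forall H : cgraph n,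
    boundary H = boundary G ->
    dist_mx H (boundary G) = bd_mx G ->
    isomorphic G H.

(* Main.v *)
Require Import Defs.
From mathcomp Require Import all_boot perm matrix.
Set Implicit Arguments.
Unset Strict Implicit.
Unset Printing Implicit Defensive.

(** Each counterexample comes from a vertex, or a family of vertices, outside
    the boundary that can be attached in two ways without affecting any distance
    between boundary vertices.

    - Bipartite ([bipartite_not_BDM]): in a hexagon with one vertex doubled,
      two distinct vertices of the same colour are at distance 2, so a new
      vertex joined to a whole colour class shortens nothing.  The two colour
      classes have 4 and 3 vertices, and both choices give the same boundary
      matrix.

    - Distance-hereditary ([distance_hereditary_not_BDM]): blow up the path
      a - b - c - d by replacing b, c and d with pairs of false twins.  Three
      consecutive groups have diameter 2, so a new vertex can be joined to the
      last three groups or to the first three; it gets degree 6 or 5.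

    - Split ([split_not_BDM]): take the vertices of an octahedron as an
      independent set and six of its eight triangular faces as a clique, with
      incidence between the two parts.  As long as the two omitted faces share
      no edge, each edge of the octahedron lies in a remaining face, so adjacent
      octahedron vertices are at distance 2 and antipodal ones at distance 3.
      The omitted faces may share one vertex or be opposite.

    In each case the new vertices are not boundary vertices, since from any
    other vertex one can pass through them to a farther neighbour; the remaining
    ones are.  The two graphs are told apart by the number of vertices of some
    degree ([isomorphic_degree]).  The graphs are given by edge lists over [nat],
    so that distances, boundaries and induced paths can be computed; [not_BDM]
    reduces the failure of the BDM property to such computations. *)

(** * Computing distances and boundaries *)

Definition ord_rel n (r : rel nat) : rel 'I_n := fun i j => r i j.

(** Vertices are listed through [iota 0 n] and not through the enumeration of
    ['I_n], which does not reduce well. *)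
Definition walk_ends (r : rel nat) (n k x : nat) : seq nat :=
  iter k (fun s => [seq y <- iota 0 n | has (r^~ y) s]) [:: x].

Definition ndist (r : rel nat) (n x y : nat) : nat :=
  find (fun k => y \in walk_ends r n k x) (iota 0 n).

Definition nboundary (r : rel nat) (n v : nat) : bool :=
  has (fun u => all (fun w => r v w ==> (ndist r n u w <= ndist r n u v))
                    (iota 0 n))
      (iota 0 n).

Lemma all_iotaP n (P : pred nat) :
  reflect (forall i : 'I_n, P i) (all P (iota 0 n)).
Proof.
apply: (iffP allP) => [h i | h i]; first by apply: h; rewrite mem_iota /=.
by rewrite mem_iota /= => lt_in; apply: (h (Ordinal lt_in)).
Qed.

Lemma has_iotaP n (P : pred nat) :
  reflect (exists i : 'I_n, P i) (has P (iota 0 n)).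
Proof.
apply: (iffP hasP) => [[i]|[i Pi]]; last first.
  by exists (val i); rewrite ?mem_iota ?ltn_ord.
by rewrite mem_iota /= => lt_in Pi; exists (Ordinal lt_in).
Qed.

(** Peeling off the last step of a walk matches the last iteration. *)
Lemma mem_walk_ends n r k (x y : 'I_n) :
  ((y : nat) \in walk_ends r n k x) =
  [exists p : k.-tuple 'I_n, path (@ord_rel n r) x p && (last x p == y)].
Proof.
elim: k y => [|k IHk] y.
  rewrite inE; apply/eqP/existsP => [/val_inj -> | [p]].
    by exists [tuple]; rewrite /= eqxx.
  by rewrite tuple0 /= => /eqP ->.
rewrite [walk_ends _ _ _ _]iterS -/(walk_ends r n k x).
rewrite mem_filter mem_iota ltn_ord !andbT; apply/hasP/existsP.
  case=> z z_end r_zy.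
  have lt_zn: z < n.
    case: (k) z_end => [|k']; first by rewrite inE => /eqP ->.
    by rewrite mem_filter mem_iota => /andP[_ /andP[]].
  move: z_end; rewrite -[z]/(val (Ordinal lt_zn)) IHk.
  case/existsP=> p /andP[pp /eqP lp].
  exists [tuple of rcons p y].
  by rewrite /= rcons_path last_rcons pp lp eqxx andbT.
case=> p; case: p; elim/last_ind=> [|p z _] //= size_p.
rewrite rcons_path last_rcons => /andP[/andP[pp r_pz] /eqP <-].
exists (val (last x p)) => //; rewrite IHk; apply/existsP.
have size_pk: size p == k by move: size_p; rewrite size_rcons eqSS.
by exists (Tuple size_pk); rewrite /= pp eqxx.
Qed.

Lemma distE n r (x y : 'I_n) : dist (@ord_rel n r) x y = ndist r n x y.
Proof.
rewrite /dist card_ord; apply: eq_find => k; exact/esym/mem_walk_ends.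
Qed.

Lemma boundaryE n r (v : 'I_n) :
  (v \in boundary (@ord_rel n r)) = nboundary r n v.
Proof.
apply/bigcupP/has_iotaP => [[u _] | [u /all_iotaP bv]].
  rewrite inE => /forallP bv; exists u; apply/all_iotaP => w.
  by rewrite -!distE; apply: bv.
by exists u => //; rewrite inE; apply/forallP => w; rewrite !distE; apply: bv.
Qed.

Lemma connect_ndist n r (x y : 'I_n) :
  ndist r n x y < n -> connect (@ord_rel n r) x y.
Proof.
move=> lt_dn; have: has (fun k => (y : nat) \in walk_ends r n k x) (iota 0 n).
  by rewrite has_find size_iota.
case/hasP=> k _; rewrite mem_walk_ends => /existsP[p /andP[pp /eqP lp]].
by apply/connectP; exists p.
Qed.

(** * Graphs given by edge lists *)

Definition edge_rel (s : seq (nat * nat)) : rel nat :=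
  fun i j => ((i, j) \in s) || ((j, i) \in s).

(** The last conjunct expresses connectedness: [ndist] returns [n] when it finds
    no walk. *)
Definition wf_edges n (s : seq (nat * nat)) : bool :=
  [&& 0 < n, all (fun i => ~~ edge_rel s i i) (iota 0 n) &
      all (fun i => all (fun j => ndist (edge_rel s) n i j < n) (iota 0 n))
          (iota 0 n)].

Section EdgeListGraph.
Variables (n : nat) (s : seq (nat * nat)) (wf_s : wf_edges n s).

Fact edge_graph_gt0 : 0 < n.
Proof. by case/and3P: wf_s. Qed.

Fact edge_graph_sym : symmetric (@ord_rel n (edge_rel s)).
Proof. by move=> i j; rewrite /ord_rel /edge_rel orbC. Qed.

Fact edge_graph_irr : irreflexive (@ord_rel n (edge_rel s)).
Proof.
by move=> i; case/and3P: wf_s => _ /all_iotaP irr _; apply/negbTE/irr.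
Qed.

Fact edge_graph_connected x y : connect (@ord_rel n (edge_rel s)) x y.
Proof.
apply: connect_ndist; case/and3P: wf_s => _ _ /all_iotaP/(_ x).
by move/all_iotaP; apply.
Qed.

Definition edge_graph : cgraph n :=
  CGraph edge_graph_gt0 edge_graph_sym edge_graph_irr edge_graph_connected.

End EdgeListGraph.

(** * A computable criterion for failing to be BDM *)

Lemma isomorphic_degree n (G H : cgraph n) d :
  isomorphic G H ->
  #|[set x | #|[set y | G x y]| == d]| = #|[set x | #|[set y | H x y]| == d]|.
Proof.
case=> f GH; rewrite -[RHS](card_preimset _ (@perm_inj _ f)).
apply: eq_card => x; rewrite !inE -[in RHS](card_preimset _ (@perm_inj _ f)).
by congr (_ == _); apply: eq_card => y; rewrite !inE GH.
Qed.

Definition ndegree (r : rel nat) n x := count (r x) (iota 0 n).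

Definition degree_count (r : rel nat) n d :=
  count (fun x => ndegree r n x == d) (iota 0 n).

Lemma card_ord_count n (P : pred nat) :
  #|[set x : 'I_n | P x]| = count P (iota 0 n).
Proof. by rewrite -val_enum_ord count_map cardsE cardE size_filter enumT. Qed.

Lemma degree_countE n r d :
  #|[set x : 'I_n | #|[set y | @ord_rel n r x y]| == d]| = degree_count r n d.
Proof.
rewrite /degree_count -card_ord_count; apply: eq_card => x.
by rewrite !inE; congr (_ == _); apply: (@card_ord_count n (r x)).
Qed.

Definition same_boundary_mx (r r' : rel nat) n : bool :=
  let B := [seq v <- iota 0 n | nboundary r n v] in
  (B == [seq v <- iota 0 n | nboundary r' n v]) &&
  all (fun u => all (fun v => ndist r' n u v == ndist r n u v) B) B.

(** The second edge list provides the graph that contradicts the BDM property: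
    it has the same boundary and boundary distances, but a different number of
    vertices of degree [d]. *)
Lemma not_BDM n s t (wf_s : wf_edges n s) (d : nat) :
  wf_edges n t ->
  same_boundary_mx (edge_rel s) (edge_rel t) n ->
  degree_count (edge_rel s) n d != degree_count (edge_rel t) n d ->
  ~ BDM (edge_graph wf_s).
Proof.
move=> wf_t /andP[/eqP eqB /allP eqD] neq_deg bdm.
have eqb: boundary (edge_graph wf_t) = boundary (edge_graph wf_s).
  apply/setP=> v; rewrite !boundaryE.
  have /(congr1 (fun B => (v : nat) \in B)) := eqB.
  by rewrite !mem_filter mem_iota ltn_ord !andbT.
case/eqP: neq_deg; rewrite -!degree_countE.
apply: (@isomorphic_degree _ (edge_graph wf_s) (edge_graph wf_t)).
apply: bdm => //; apply/matrixP => i j; rewrite !mxE !distE; apply/eqP.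
have inB (v : 'I_n) : v \in boundary (edge_graph wf_s) ->
    (v : nat) \in [seq u <- iota 0 n | nboundary (edge_rel s) n u].
  by rewrite boundaryE mem_filter mem_iota ltn_ord !andbT.
have /allP := eqD _ (inB _ (enum_valP i)).
by apply; apply: inB (enum_valP j).
Qed.

(** * Checking distance-heredity and the diameter *)

(** For [i, j < k], the adjacency of the path on [k] vertices. *)
Definition succ_rel : rel nat := fun i j => (i.+1 == j) || (j.+1 == i).

(** An induced path is extended at its head: the new vertex must be adjacent to
    the previous head, which has index 0, and to no other vertex.  Building paths
    this way avoids running through all sequences of [k] vertices. *)
Fixpoint induced_paths (r : rel nat) (n k : nat) : seq (seq nat) :=
  if k is k'.+1 then
    [seq x :: p | p <- induced_paths r n k',
                  x <- [seq x <- iota 0 n |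
                         all (fun j => r x (nth 0 p j) == (j == 0))
                             (iota 0 k') && (x \notin p)]]
  else [:: [::]].

Lemma mem_induced_paths n r k (f : 'I_k -> 'I_n) :
  induced_path (@ord_rel n r) f ->
  [seq (f i : nat) | i <- enum 'I_k] \in induced_paths r n k.
Proof.
elim: k f => [|k IHk] f [inj_f ind_f].
  by rewrite [map _ _]size0nil // size_map size_enum_ord.
rewrite enum_ordSl /= -map_comp; apply/allpairsPdep.
exists [seq (f (lift ord0 i) : nat) | i <- enum 'I_k], (f ord0 : nat).
split=> //.
  apply: IHk; split=> [i j /inj_f/lift_inj // | i j].
  by rewrite ind_f /path_rel !lift0 !eqSS.
rewrite mem_filter mem_iota ltn_ord !andbT; apply/andP; split.
  apply/all_iotaP => j.
  rewrite (nth_map j) ?size_enum_ord // nth_ord_enum.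
  have := ind_f ord0 (lift ord0 j).
  by rewrite /ord_rel /path_rel lift0 /= orbF eqSS eq_sym => ->.
apply/mapP=> [[i _ /val_inj/inj_f]] /(congr1 val) /=.
by rewrite /bump.
Qed.

(** Finitely many lengths suffice: an induced path contains shorter ones, so if
    none has [K] vertices then none is longer. *)
Definition dh_check (r : rel nat) n K : bool :=
  (induced_paths r n K == [::]) &&
  all (fun k => all (fun p =>
    all (fun i => all (fun j =>
      ndist r n (nth 0 p i) (nth 0 p j) == ndist succ_rel k i j)
      (iota 0 k)) (iota 0 k)) (induced_paths r n k)) (iota 0 K).

Lemma dh_checkP n r K : dh_check r n K -> distance_hereditary (@ord_rel n r).
Proof.
case/andP=> /eqP noK /allP iso k f /mem_induced_paths pf i j.
have lt_kK: k < K.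
  rewrite ltnNge; apply/negP => le_Kk.
  suffices none m : induced_paths r n (K + m) = [::].
    by have := none (k - K); rewrite subnKC // => no_k; rewrite no_k in pf.
  by elim: m => [|m IHm]; rewrite ?addn0 // addnS /= IHm.
have k_iota: k \in iota 0 K by rewrite mem_iota.
have /allP/(_ _ pf)/all_iotaP/(_ i)/all_iotaP/(_ j)/eqP := iso _ k_iota.
by rewrite !(nth_map i) -?enumT ?size_enum_ord // !nth_ord_enum -!distE.
Qed.

Lemma diameter_eq n r d :
  all (fun x => all (fun y => ndist r n x y <= d) (iota 0 n)) (iota 0 n) ->
  has (fun x => has (fun y => ndist r n x y == d) (iota 0 n)) (iota 0 n) ->
  diameter (@ord_rel n r) = d.
Proof.
move=> /all_iotaP le_d /has_iotaP[x /has_iotaP[y /eqP def_d]].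
apply/eqP; rewrite eqn_leq; apply/andP; split.
  apply/bigmax_leqP => u _; apply/bigmax_leqP => v _; rewrite distE.
  by have /all_iotaP := le_d u; apply.
rewrite -def_d -distE; apply: leq_trans (leq_bigmax x).
exact: (leq_bigmax (F := fun y => dist _ x y)).
Qed.

(** * The bipartite graph *)

(** The hexagon is 0, ..., 5; the vertex 6 is a twin of 0 and 7 is the centre. *)
Definition twinned_hexagon (center_nbrs : seq nat) : seq (nat * nat) :=
  [:: (0, 1); (1, 2); (2, 3); (3, 4); (4, 5); (5, 0); (6, 1); (6, 5)]
  ++ [seq (7, i) | i <- center_nbrs].

Fact wf_even_hexagon : wf_edges 8 (twinned_hexagon [:: 0; 2; 4; 6]).
Proof. by vm_compute. Qed.

Fact wf_odd_hexagon : wf_edges 8 (twinned_hexagon [:: 1; 3; 5]).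
Proof. by vm_compute. Qed.

(** The centre is not a boundary vertex: from a neighbour, its other neighbours
    are at distance 2 while it is at distance 1; from any other vertex it is at
    distance 2, and a hexagon vertex opposite to that one is a neighbour of the
    centre at distance 3.  The number of vertices of degree 2 is 1 when the centre
    is joined to the even vertices and 4 when it is joined to the odd ones. *)
Lemma bipartite_not_BDM :
  bipartite (edge_graph wf_even_hexagon) /\ ~ BDM (edge_graph wf_even_hexagon).
Proof.
split; last by apply: (not_BDM (d := 2) wf_odd_hexagon); vm_compute.
pose r := edge_rel (twinned_hexagon [:: 0; 2; 4; 6]).
have odd_r (x y : 'I_8) : odd x == odd y -> ~~ r x y.
  move=> eq_xy; have /all_iotaP/(_ x)/all_iotaP/(_ y)/implyP : all (fun x =>
    all (fun y => (odd x == odd y) ==> ~~ r x y) (iota 0 8)) (iota 0 8).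
    by vm_compute.
  exact.
exists [set i : 'I_8 | odd i]; split=> x y; rewrite !inE.
  by move=> ox oy; apply: odd_r; rewrite ox oy.
by move=> /negbTE ox /negbTE oy; apply: odd_r; rewrite ox oy.
Qed.

(** * The distance-hereditary graph *)

(** The groups of the blown-up path are 0, then 1 and 2, then 3 and 4, then 5
    and 6; the vertex 7 is the centre. *)
Definition blown_up_path (center_nbrs : seq nat) : seq (nat * nat) :=
  [:: (0, 1); (0, 2); (1, 3); (1, 4); (2, 3); (2, 4);
      (3, 5); (3, 6); (4, 5); (4, 6)]
  ++ [seq (7, i) | i <- center_nbrs].

Fact wf_right_center : wf_edges 8 (blown_up_path [:: 1; 2; 3; 4; 5; 6]).
Proof. by vm_compute. Qed.

Fact wf_left_center : wf_edges 8 (blown_up_path [:: 0; 1; 2; 3; 4]).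
Proof. by vm_compute. Qed.

(** With the centre joined to the last three groups it has degree 6; with the
    centre joined to the first three groups no degree exceeds 5.  The centre is
    not a boundary vertex: from a neighbour that has a twin, this twin is a
    neighbour of the centre at distance 2; from the vertex 0, or from a vertex
    not joined to the centre, some group joined to it is farther than it is.
    For distance-heredity, no induced path has 5 vertices. *)
Lemma distance_hereditary_not_BDM :
  distance_hereditary (edge_graph wf_right_center) /\
  ~ BDM (edge_graph wf_right_center).
Proof.
split; first by apply: (@dh_checkP _ _ 5); vm_compute.
by apply: (not_BDM (d := 6) wf_left_center); vm_compute.
Qed.

(** * The split graph *)

(** The antipodal pairs of the octahedron are 0 and 1, 2 and 3, 4 and 5, so a
    face picks one vertex from each pair.  The list leaves out 024, 035 and 135;
    putting back 135 or 035 leaves two omitted faces that share only the vertex 0,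
    or that are opposite. *)
Definition octahedron_faces : seq (seq nat) :=
  [:: [:: 0; 2; 5]; [:: 0; 3; 4]; [:: 1; 2; 4]; [:: 1; 2; 5]; [:: 1; 3; 4]].

Definition face_graph (last_face : seq nat) : seq (nat * nat) :=
  [seq (6 + i, 6 + j) | i <- iota 0 6, j <- iota 0 i]
  ++ [seq (6 + i, v) | i <- iota 0 6,
                       v <- nth [::] (rcons octahedron_faces last_face) i].

Fact wf_touching_omitted : wf_edges 12 (face_graph [:: 1; 3; 5]).
Proof. by vm_compute. Qed.

Fact wf_opposite_omitted : wf_edges 12 (face_graph [:: 0; 3; 5]).
Proof. by vm_compute. Qed.

(** A face is not a boundary vertex: from an octahedron vertex not on it, it is
    at distance 2 and contains the antipode, which is at distance 3; from one of its
    own vertices or from another face it is at distance 1 and has a vertex at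
    distance 2.  An octahedron vertex has as degree the number of remaining faces
    through it: when the omitted faces share a vertex, that vertex has degree 2,
    and when they are opposite every octahedron vertex has degree 3. *)
Lemma split_not_BDM :
  split_graph (edge_graph wf_touching_omitted) /\
  diameter (edge_graph wf_touching_omitted) = 3 /\
  ~ BDM (edge_graph wf_touching_omitted).
Proof.
pose r := edge_rel (face_graph [:: 1; 3; 5]).
split; last first.
  split; first by apply: diameter_eq; vm_compute.
  by apply: (not_BDM (d := 2) wf_opposite_omitted); vm_compute.
have /all_iotaP split_r: all (fun x => all (fun y =>
    if (6 <= x) && (6 <= y) then (x != y) ==> r x y
    else (x < 6) && (y < 6) ==> ~~ r x y) (iota 0 12)) (iota 0 12).
  by vm_compute.
exists [set i : 'I_12 | 6 <= i]; split=> x y; rewrite !inE.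
  by move=> x6 y6; have /all_iotaP/(_ y) := split_r x; rewrite x6 y6 => /implyP.
rewrite -!ltnNge => x6 y6; have /all_iotaP/(_ y) := split_r x.
by rewrite x6 y6 leqNgt x6.
Qed.

Theorem mainTheorem5 :
  ~ (forall (n : nat) (G : cgraph n), BDM G) /\
  (exists (n : nat) (G : cgraph n), bipartite G /\ ~ BDM G) /\
  (exists (n : nat) (G : cgraph n),
      8 <= n /\ distance_hereditary G /\ ~ BDM G) /\
  (exists (n : nat) (G : cgraph n),
      10 <= n /\ split_graph G /\ diameter G = 3 /\ ~ BDM G).
Proof.
split; first by case: bipartite_not_BDM => _ nbdm bdm; apply: nbdm; apply: bdm.
split.
  by exists 8, (edge_graph wf_even_hexagon); apply: bipartite_not_BDM.
split.
  exists 8, (edge_graph wf_right_center).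
  by split; last apply: distance_hereditary_not_BDM.
exists 12, (edge_graph wf_touching_omitted).
by split; last apply: split_not_BDM.
Qed.
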